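(* Let $K$ be a field, $R=K[x_0,\dots,x_N]=K[\mathbf{P}^N]$ and $M=(x_0,\dots,x_N)$. Let $p_1,\dots,p_n\in\mathbf{P}^N$ be distinct points, and let $I=\bigcap_i I(p_i)\subset R$. If $I^{(Nr)}\subseteq M^{r(N-1)}I^r$ holds for all $r\ge 1$, then $$\frac{\alpha(I^{(m)})}{m}\ge\frac{\alpha(I)+N-1}{N}$$ holds for all $m\ge 1$.
   Context: For a point $p\in\mathbf{P}^N$ (a $K$-rational point), $I(p)\subset R$ is the ideal generated by all forms vanishing at $p$. For $I=\bigcap_i I(p_i)$ with distinct $p_i$, the $m$-th symbolic power is $I^{(m)}=\bigcap_i I(p_i)^m$. For a nonzero homogeneous ideal $J$, $\alpha(J)$ is the smallest integer $l$ such that the degree-$l$ component $J_l$ is nonzero. *)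

(* Defs.v *)
From mathcomp Require Import all_boot all_order all_algebra.
From mathcomp Require Import mpoly.
From mathcomp Require Import boolp classical_sets.

Set Implicit Arguments.
Unset Strict Implicit.
Unset Printing Implicit Defensive.

Import GRing.Theory.

Local Open Scope ring_scope.
Local Open Scope classical_set_scope.

Section Ideals.
Variable R : comNzRingType.

(* Unlike [idealr_closed], properness is not required: the unit ideal is
   allowed, being the zeroth power of every ideal. *)
Definition is_ideal (J : set R) : Prop :=
  [/\ J 0, forall x y, J x -> J y -> J (x + y) & forall a x, J x -> J (a * x)].

Definition ideal_gen (S : set R) : set R := smallest is_ideal S.

Definition ideal_mul (I J : set R) : set R :=
  ideal_gen [set a * b | a in I & b in J].

Definition ideal_pow (I : set R) (n : nat) : set R :=
  iter n (ideal_mul I) setT.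

End Ideals.

(* Points are the lines through the origin in K^(N+1), so that equality of
   points is Leibniz equality. *)
Definition proj_point (K : fieldType) (N : nat) :=
  {L : {vspace 'rV[K]_N.+1} | \dim L == 1%N}.

Section ProjectiveSpace.
Variables (K : fieldType) (N : nat).
Local Notation R := {mpoly K[N.+1]}.

Definition irrelevant_ideal : set R := ideal_gen (range (fun i => 'X_i)).

Definition is_form (f : R) : Prop := exists d : nat, f \is d.-homog.

Definition vanishes_at (f : R) (p : proj_point K N) : Prop :=
  forall v, v \in val p -> f.@[v ord0] = 0.

Definition point_ideal (p : proj_point K N) : set R :=
  ideal_gen [set f | is_form f /\ vanishes_at f p].

Definition points_ideal (n : nat) (p : 'I_n -> proj_point K N) : set R :=
  \bigcap_i point_ideal (p i).

Definition symbolic_power (n : nat) (p : 'I_n -> proj_point K N) (m : nat) :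
    set R :=
  \bigcap_i ideal_pow (point_ideal (p i)) m.

(* The test [f != 0] matters: the zero polynomial is homogeneous of every
   degree. *)
Definition nonzero_component (J : set R) (l : nat) : Prop :=
  exists f : R, [/\ J f, f \is l.-homog & f != 0].

(* The value 0 is a convention for the case where all the components of J are
   zero, which for a homogeneous ideal means J = 0. *)
Definition alpha (J : set R) : nat :=
  match pselect (exists l, `[< nonzero_component J l >]) with
  | left ex_l => ex_minn ex_l
  | right _ => 0%N
  end.

End ProjectiveSpace.

Arguments irrelevant_ideal : clear implicits.

(* Main.v *)
Require Import Defs.
From mathcomp Require Import all_boot all_order all_algebra.
From mathcomp Require Import mpoly.
From mathcomp Require Import boolp classical_sets.

Local Open Scope ring_scope.
Local Open Scope classical_set_scope.

(** Take a nonzero form [f] of degree [alpha (I^(m))] in [I^(m)]; it exists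
    because the product of the [m]-th powers of linear forms through the points
    lies in [I^(m)]. Then [f ^+ N] lies in [I^(N m)], hence in
    [M^(m (N - 1)) I^m] by the hypothesis for [r = m]. The ideal [I] is
    homogeneous, so elements of this product have no component below degree
    [m (N - 1) + m * alpha I], and a comparison with the degree of [f ^+ N]
    concludes. *)

Import Order.TTheory GRing.Theory Num.Theory.

Section IdealTheory.
Set Implicit Arguments.
Unset Strict Implicit.
Variable R : comNzRingType.
Implicit Types (I J : set R) (S : set R).

Lemma ideal_gen_ideal S : is_ideal (ideal_gen S).
Proof.
split=> [A [[A0 _ _] _] |x y Sx Sy A AS|a x Sx A AS] //.
  by case: (AS) => -[_ AD _] _; apply: AD; [apply: Sx | apply: Sy].
by case: (AS) => -[_ _ AM] _; apply: AM; apply: Sx.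
Qed.

Lemma sub_ideal_gen S : S `<=` ideal_gen S.
Proof. exact: sub_gen_smallest. Qed.

Lemma ideal_gen_sub S J : is_ideal J -> S `<=` J -> ideal_gen S `<=` J.
Proof. exact: smallest_sub. Qed.

Lemma ideal_powS I k : ideal_pow I k.+1 = ideal_mul I (ideal_pow I k).
Proof. by []. Qed.

Lemma ideal_pow_ideal I k : is_ideal (ideal_pow I k).
Proof. by case: k => [|k]; [split | apply: ideal_gen_ideal]. Qed.

Lemma mem_ideal_mul I J a b : I a -> J b -> ideal_mul I J (a * b).
Proof. by move=> Ia Jb; apply: sub_ideal_gen; exists a => //; exists b. Qed.

Lemma ideal_powX I k x : I x -> ideal_pow I k (x ^+ k).
Proof. by move=> Ix; elim: k => // k IHk; rewrite exprS; apply: mem_ideal_mul. Qed.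

Lemma ideal_powD I a b f g :
  ideal_pow I a f -> ideal_pow I b g -> ideal_pow I (a + b) (f * g).
Proof.
elim: a f => [|a IHa] f Iaf Ibg; first by case: (ideal_pow_ideal I b) => _ _; apply.
(* For fixed [g], [J] is a colon ideal, so the inclusion need only be checked on the generators
   [x * y] of [ideal_pow I a.+1], where induction applies to [y * g]. *)
pose J := [set h | ideal_pow I (a.+1 + b) (h * g)].
suff: ideal_pow I a.+1 `<=` J by apply.
have [I0 ID IM] := ideal_pow_ideal I (a.+1 + b).
apply: ideal_gen_sub => [|_ [x Ix [y Iay <-]]].
  split=> [|h1 h2|c h]; rewrite /J /=.
  - by rewrite mul0r.
  - by rewrite mulrDl; apply: ID.
  - by rewrite -mulrA; apply: IM.
rewrite /J /mkset -mulrA addSn ideal_powS.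
by apply: mem_ideal_mul => //; apply: IHa.
Qed.

Lemma ideal_powM I m k f : ideal_pow I m f -> ideal_pow I (k * m) (f ^+ k).
Proof.
by move=> If; elim: k => // k IHk; rewrite mulSn exprS; apply: ideal_powD.
Qed.

End IdealTheory.

Section Homogeneous.
Set Implicit Arguments.
Unset Strict Implicit.
Variables (K : fieldType) (N : nat).
Local Notation R := {mpoly K[N.+1]}.
Local Notation homog_part := (pihomog (mdeg (n := N.+1))).
Implicit Types (f g : R) (J : set R).

(** Both factors are split into homogeneous parts. The bounds [k] and [l], which exceed every degree
    occurring in [f] and [g], stay existential because only the shape of the sum matters later. *)
Lemma homog_partM e f g :
  exists k l, homog_part e (f * g) =
    \sum_(i < k) \sum_(j < l | (i + j)%N == e) homog_part i f * homog_part j g.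
Proof.
exists (mmeasure mdeg f), (mmeasure mdeg g).
rewrite {1}(pihomog_partitionE (leqnn (mmeasure mdeg f))).
rewrite {1}(pihomog_partitionE (leqnn (mmeasure mdeg g))).
rewrite mulr_suml raddf_sum; apply: eq_bigr => i _ /=.
rewrite mulr_sumr raddf_sum [RHS]big_mkcond; apply: eq_bigr => j _ /=.
have hom : homog_part i f * homog_part j g \is (i + j).-homog.
  by apply: dhomogM; apply: pihomogP.
case: eqP => [<-|/eqP ne]; first exact: pihomog_dE.
exact: pihomog_ne0 ne hom.
Qed.

(** This is the ideal $M^d$ in terms of components, a form in which membership directly bounds
    degrees. *)
Definition order_ge (d : nat) : set R :=
  [set f | forall e, (e < d)%N -> homog_part e f = 0].

Lemma order_geM a b f g :
  order_ge a f -> order_ge b g -> order_ge (a + b) (f * g).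
Proof.
move=> fa gb e lt_e; have [k [l ->]] := homog_partM e f g.
apply: big1 => i _; apply: big1 => j /eqP ij.
case: (ltnP i a) => [/fa ->|le_ai]; first by rewrite mul0r.
(* From [i + j = e < a + b] and [a <= i] it follows that [j < b]. *)
rewrite (gb j) ?mulr0 // -(ltn_add2l a).
by apply: leq_ltn_trans lt_e; rewrite -ij leq_add2r.
Qed.

Lemma order_ge_ideal d : is_ideal (order_ge d).
Proof.
split=> [e _|f g fd gd e lt_e|a f fd]; first exact: raddf0.
  by rewrite raddfD /= fd // gd // addr0.
(* Every polynomial lies in [order_ge 0], so absorption is a case of the product rule. *)
by rewrite -[d]add0n; apply: order_geM.
Qed.

Lemma order_ge_mul I J a b :
  I `<=` order_ge a -> J `<=` order_ge b -> ideal_mul I J `<=` order_ge (a + b).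
Proof.
move=> Ia Jb; apply: ideal_gen_sub; first exact: order_ge_ideal.
by move=> _ [x Ix [y Jy <-]]; apply: order_geM; [apply: Ia | apply: Jb].
Qed.

Lemma order_ge_pow I a k :
  I `<=` order_ge a -> ideal_pow I k `<=` order_ge (k * a).
Proof.
move=> Ia; elim: k => [//|k IHk]; rewrite mulSn ideal_powS.
exact: order_ge_mul.
Qed.

Lemma order_ge_homog d l f :
  f \is l.-homog -> f != 0 -> order_ge d f -> (d <= l)%N.
Proof.
move=> hom nz fd; rewrite leqNgt; apply/negP => /fd.
by rewrite pihomog_dE // => /eqP; apply/negP.
Qed.

Lemma irrelevant_order_ge : irrelevant_ideal K N `<=` order_ge 1.
Proof.
apply: ideal_gen_sub; first exact: order_ge_ideal.
move=> _ [i _ <-] [|//] _; apply: (@pihomog_ne0 _ _ _ 1%N) => //.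
by rewrite dhomogX; apply/eqP; apply: mdeg1.
Qed.

Definition homogeneous (J : set R) : Prop :=
  forall f e, J f -> J (homog_part e f).

(** The polynomials with all components in [ideal_gen S] form an ideal: a component of [a * f] is a
    combination of components of [f]. This ideal contains [S], since a form has only one possibly
    nonzero component. *)
Lemma homogeneous_gen S : (forall f, S f -> is_form f) ->
  homogeneous (ideal_gen S).
Proof.
move=> hS f e; have [J0 JD JM] := ideal_gen_ideal S.
move=> Jf; move: f Jf e.
suff: ideal_gen S `<=`
    [set f | forall e, ideal_gen S (homog_part e f)] by [].
apply: ideal_gen_sub => [|f Sf e /=].
  split=> [e|f g Jf Jg e|a f Jf e] /=.
  - by rewrite raddf0.
  - rewrite raddfD; apply: JD; [apply: Jf | apply: Jg].
  - have [k [l ->]] := homog_partM e a f.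
    by elim/big_ind: _ => // i _; elim/big_ind: _ => // j _; apply: JM.
have [d hom] := hS f Sf; have [<-|ne] := eqVneq d e.
  by rewrite pihomog_dE //; apply: sub_ideal_gen.
by rewrite (pihomog_ne0 ne hom).
Qed.

Lemma alpha_le J l : nonzero_component J l -> (alpha J <= l)%N.
Proof.
move=> Jl; rewrite /alpha; case: pselect => // ex_l.
by case: ex_minnP => k _; apply; apply/asboolP.
Qed.

Lemma alpha_component J :
  (exists l, nonzero_component J l) -> nonzero_component J (alpha J).
Proof.
case=> l Jl; rewrite /alpha; case: pselect => [ex_l|[]].
  by case: ex_minnP => k /asboolP.
by exists l; apply/asboolP.
Qed.

(** A nonzero component of an element of [J] is itself a form in [J], so its degree is at least
    [alpha J] by minimality. *)
Lemma homogeneous_order_ge J : homogeneous J -> J `<=` order_ge (alpha J).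
Proof.
move=> hJ f Jf e; apply: contraTeq => nz; rewrite -leqNgt.
by apply: alpha_le; exists (homog_part e f); split=> //; [apply: hJ | apply: pihomogP].
Qed.

Lemma points_ideal_homogeneous n (p : 'I_n -> proj_point K N) :
  homogeneous (points_ideal p).
Proof.
by move=> f e If i _; apply: homogeneous_gen; [move=> g [] | apply: If].
Qed.

Lemma linear_form_through (p : proj_point K N) : (0 < N)%N ->
  exists f : R, [/\ f \is 1.-homog, f != 0 & vanishes_at f p].
Proof.
move=> N_gt0; case: p => L /= dimL.
pose v := vpick L; have vL : v \in L by apply: memv_pick.
have v0 : v != 0 by rewrite vpick0 -dimv_eq0 (eqP dimL).
have LE : L = <[v]>%VS.
  by apply/eqP; rewrite eq_sym eqEdim dim_vline v0 (eqP dimL) -memvE vL.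
pose i0 : 'I_N.+1 := ord0; pose i1 : 'I_N.+1 := ord_max.
have ne01 : i0 != i1 by rewrite -val_eqE /= eq_sym -lt0n.
have hX i : ('X_i : R) \is 1.-homog by rewrite dhomogX; apply/eqP; apply: mdeg1.
(* The point is spanned by [v]. If its coordinate $v_0$ is zero, $X_0$ vanishes there; otherwise
   $v_N X_0 - v_0 X_N$ does, and its coefficient $-v_0$ makes it nonzero. *)
have [v00|nz0] := eqVneq (v ord0 i0) 0.
  exists 'X_i0; split=> //.
    apply/eqP => /(congr1 (mcoeff U_(i0))); rewrite mcoeffXU eqxx mcoeff0.
    by apply/eqP; apply: oner_neq0.
  by move=> w; rewrite /= LE => /vlineP[k ->]; rewrite mevalXU mxE v00 mulr0.
exists (v ord0 i1 *: 'X_i0 - v ord0 i0 *: 'X_i1); split.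
- by rewrite rpredB // rpredZ.
- apply/eqP => /(congr1 (mcoeff U_(i1))).
  rewrite mcoeffB !mcoeffZ !mcoeffXU eqxx (negPf ne01) mcoeff0 mulr0 sub0r mulr1.
  by apply/eqP; rewrite oppr_eq0.
- move=> w; rewrite /= LE => /vlineP[k ->].
  by rewrite mevalB !mevalZ !mevalXU !mxE mulrCA [v ord0 i0 * _]mulrCA
    [v ord0 i1 * _]mulrC subrr.
Qed.

Lemma symbolic_power_component n (p : 'I_n -> proj_point K N) m :
  (0 < N)%N -> exists l, nonzero_component (symbolic_power p m) l.
Proof.
move=> N_gt0; have [l hl] := choice (fun i => linear_form_through (p i) N_gt0).
exists (\sum_(i < n) m)%N, (\prod_(i < n) l i ^+ m); split.
(* The factor [l i ^+ m] alone lies in the [m]-th power of the ideal of [p i], which absorbs the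
   other factors. *)
- move=> i _; rewrite (bigD1 i) //= mulrC.
  have [_ _ ] := ideal_pow_ideal (point_ideal (p i)) m; apply.
  apply: ideal_powX; apply: sub_ideal_gen.
  by have [hom _ van] := hl i; split=> //; exists 1%N.
- elim/big_rec2: _ => [|i d f _ hf]; first exact: dhomog1.
  apply: dhomogM => //; rewrite -[m in m.-homog]mul1n.
  by apply: dhomogMn; case: (hl i).
- by apply/prodf_neq0 => i _; rewrite expf_neq0 //; case: (hl i).
Qed.

End Homogeneous.

Theorem lemma3p2 (K : fieldType) (N n : nat) (N_gt0 : (0 < N)%N)
    (n_gt0 : (0 < n)%N) (p : 'I_n -> proj_point K N) (p_inj : injective p)
    (hI : forall r : nat, (1 <= r)%N ->
       symbolic_power p (N * r)
         `<=` ideal_mul (ideal_pow (irrelevant_ideal K N) (r * (N - 1)))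
                        (ideal_pow (points_ideal p) r))
    (m : nat) (m_ge1 : (1 <= m)%N) :
  ((alpha (points_ideal p))%:R + N%:R - 1) / N%:R
    <= (alpha (symbolic_power p m))%:R / m%:R :> rat.
Proof.
have [f [If hom nz]] := alpha_component (symbolic_power_component p m N_gt0).
have /(hI m m_ge1) fN : symbolic_power p (N * m) (f ^+ N).
  by move=> i _; apply: ideal_powM; apply: If.
(* The factor [1] is the order of the elements of $M$. *)
have order_fN : order_ge (m * (N - 1) * 1 + m * alpha (points_ideal p))%N (f ^+ N).
  apply: order_ge_mul fN; apply: order_ge_pow; first exact: irrelevant_order_ge.
  by apply: homogeneous_order_ge; apply: points_ideal_homogeneous.
(* The form [f ^+ N] has degree [alpha (symbolic_power p m) * N], which the order cannot exceed. *)
have := order_ge_homog (dhomogMn N hom) (expf_neq0 N nz) order_fN.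
rewrite muln1 -mulnDr => le_deg.
rewrite -addrA ler_pdivrMr ?ltr0n // mulrAC ler_pdivlMr ?ltr0n //.
(* Since [0 < N], the truncated subtraction in the exponent agrees with the rational one. *)
have -> : N%:R - 1 = (N - 1)%:R :> rat by rewrite natrB.
by rewrite -natrD -!natrM ler_nat addnC mulnC.
Qed.
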